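(* Let $\mathcal{B}$ be the complex Lie algebra with basis $\{L_{\alpha,i},\,C \mid \alpha,i\in\mathbb{Z},\ i\ge 0\}$, with $C$ central and $$[L_{\alpha,i},L_{\beta,j}]=\big((i+1)\beta-(j+1)\alpha\big)L_{\alpha+\beta,i+j}+\delta_{\alpha+\beta,0}\,\delta_{i+j,0}\,\frac{\alpha^3-\alpha}{6}\,C ,$$ let $\mathrm{Vir}=\mathrm{span}\{L_{\alpha,0},\,C\mid\alpha\in\mathbb{Z}\}\subset\mathcal{B}$ (a subalgebra isomorphic to the Virasoro algebra), and let $\mathcal{B}_1=\mathrm{span}\{L_{\alpha,i}\mid\alpha\in\mathbb{Z},\ i\ge 1\}$. Then every module of the intermediate series over $\mathcal{B}$ is simply a module of the intermediate series over $\mathrm{Vir}$ with the trivial action of $\mathcal{B}_1$; that is, if $V$ is a $\mathcal{B}$-module of the intermediate series, then $\mathcal{B}_1V=0$ and the restriction of $V$ to $\mathrm{Vir}$ is a $\mathrm{Vir}$-module of the intermediate series.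
   Context: All vector spaces are over $\mathbb{C}$. The Lie algebra $\mathcal{B}$ is $\mathbb{Z}$-graded, its degree-$\alpha$ component being $\mathrm{span}\{L_{\alpha,i}\mid i\ge 0\}$ for $\alpha\neq 0$ and $\mathrm{span}\{L_{0,i},\,C\mid i\ge 0\}$ for $\alpha=0$; $\mathrm{Vir}$ inherits this gradation. In this statement $\mathcal{B}_1$ denotes the span of the $L_{\alpha,i}$ with $i\ge1$ (an ideal of $\mathcal{B}$), not the degree-$1$ component. A module $V$ over $\mathcal{B}$ (respectively $\mathrm{Vir}$) is $\mathbb{Z}$-graded if $V=\bigoplus_{\beta\in\mathbb{Z}}V_\beta$ and each element of degree $\alpha$ of the Lie algebra maps $V_\beta$ into $V_{\alpha+\beta}$. It is a module of the intermediate series if it is $\mathbb{Z}$-graded and $\dim V_\beta\le 1$ for all $\beta\in\mathbb{Z}$. *)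

(* Defs.v *)
From HB Require Import structures.
From mathcomp Require Import all_boot all_order all_algebra.
From mathcomp Require Import boolp classical_sets reals.
From mathcomp Require Import finmap complex ring.
From mathcomp Require Import monalg.

Set Implicit Arguments.
Unset Strict Implicit.
Unset Printing Implicit Defensive.

Import Order.TTheory GRing.Theory Num.Theory.

Local Open Scope classical_set_scope.
Local Open Scope ring_scope.

Section LinearAlgebra.
Context {K : fieldType} {V : lmodType K}.

Definition span (S : set V) : set V :=
  [set x | exists (n : nat) (c : 'I_n -> K) (v : 'I_n -> V),
     (forall i, S (v i)) /\ x = \sum_(i < n) c i *: v i].

Definition subspace (W : set V) : Prop :=
  W 0 /\ forall (a : K) (x y : V), W x -> W y -> W (a *: x + y).

Definition dim_le (W : set V) (n : nat) : Prop :=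
  exists v : 'I_n -> V, (forall i, W (v i)) /\
    forall x, W x -> exists c : 'I_n -> K, x = \sum_(i < n) c i *: v i.

Definition direct_sum_decomposition (I : choiceType) (W : I -> set V) : Prop :=
  [/\ forall i, subspace (W i),
      forall x, exists (s : seq I) (w : I -> V),
        [/\ uniq s, forall i, W i (w i) & x = \sum_(i <- s) w i]
    & forall (s : seq I) (w : I -> V), uniq s -> (forall i, W i (w i)) ->
        \sum_(i <- s) w i = 0 -> forall i, i \in s -> w i = 0].

Lemma span_gen (S : set V) : S `<=` span S.
Proof.
move=> x Sx; exists 1%N, (fun=> 1), (fun=> x); split=> //.
by rewrite big_ord1 scale1r.
Qed.

Lemma span_subspace (S : set V) : subspace (span S).
Proof.
split.
  by exists 0%N, (fun=> 0), (fun=> 0); split; [case|rewrite big_ord0].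
move=> a _ _ [n [c [v [Sv ->]]]] [m [d [w [Sw ->]]]].
exists (n + m)%N,
  (fun i => match fintype.split i with inl j => a * c j | inr j => d j end),
  (fun i => match fintype.split i with inl j => v j | inr j => w j end).
split; first by move=> i; case: (fintype.split i).
rewrite big_split_ord /= scaler_sumr; congr (_ + _); apply: eq_bigr => i _.
  by rewrite (unsplitK (inl i)) scalerA.
by rewrite (unsplitK (inr i)).
Qed.

Lemma span_ind (S W : set V) : subspace W -> S `<=` W -> span S `<=` W.
Proof.
move=> [W0 WD] SW _ [n [c [v [Sv ->]]]].
elim/big_ind: _ => // [x y Wx Wy|i _]; first by rewrite -[x]scale1r; exact: WD.
by rewrite -[_ *: _]addr0; apply: WD => //; exact/SW.
Qed.

End LinearAlgebra.

HB.mixin Record Lmodule_isLieAlgebra (K : fieldType) G of GRing.Lmodule K G := {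
  lie : G -> G -> G;
  lie_linearl : forall y, linear (lie^~ y);
  lie_linearr : forall x, linear (lie x);
  liexx : forall x, lie x x = 0;
  lie_jacobi : forall x y z,
    lie x (lie y z) + lie y (lie z x) + lie z (lie x y) = 0
}.

#[short(type="lieAlgType")]
HB.structure Definition LieAlgebra (K : fieldType) :=
  {G of Lmodule_isLieAlgebra K G & GRing.Lmodule K G}.

Section Modules.
Context {K : fieldType} {G : lieAlgType K} {V : lmodType K}.

Definition lie_module (act : G -> V -> V) : Prop :=
  [/\ forall v, linear (act^~ v),
      forall x, linear (act x)
    & forall x y v, act (lie x y) v = act x (act y v) - act y (act x v)].

Definition graded_module (Gd : int -> set G) (Vd : int -> set V)
    (act : G -> V -> V) : Prop :=
  [/\ lie_module act, direct_sum_decomposition Vd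
    & forall (a b : int) x v, Gd a x -> Vd b v -> Vd (a + b) (act x v)].

(* A module together with the gradation [Vd] witnessing that it belongs to the
   intermediate series *)
Definition intermediate_series (Gd : int -> set G) (Vd : int -> set V)
    (act : G -> V -> V) : Prop :=
  graded_module Gd Vd act /\ forall b, dim_le (Vd b) 1.

End Modules.

Section LinearExtension.
Context {K : fieldType} {I : choiceType} {V : lmodType K}.
Implicit Types (f : I -> V) (x : {malg K[I]}).

Definition lin_ext f x : V := \sum_(k <- msupp x) x@_k *: f k.

Lemma lin_extEw f x (d : {fset I}) : (msupp x `<=` d)%fset ->
  lin_ext f x = \sum_(k <- d) x@_k *: f k.
Proof.
move=> le; apply: big_fset_incl => // k _.
by rewrite -mcoeff_eq0 => /eqP ->; rewrite scale0r.
Qed.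

Lemma lin_ext_linear f : linear (lin_ext f).
Proof.
move=> a x y; pose d := (msupp x `|` msupp y `|` msupp (a *: x + y))%fset.
have dx : (msupp x `<=` d)%fset by rewrite /d -fsetUA fsubsetUl.
have dy : (msupp y `<=` d)%fset by rewrite /d fsetUAC fsubsetUr.
have ds : (msupp (a *: x + y) `<=` d)%fset by rewrite /d fsubsetUr.
rewrite (lin_extEw f dx) (lin_extEw f dy) (lin_extEw f ds).
rewrite scaler_sumr -big_split /=; apply: eq_bigr => k _.
by rewrite mcoeffD mcoeffZ scalerDl scalerA.
Qed.

Lemma lin_extU f k : lin_ext f << k >> = f k.
Proof.
rewrite (lin_extEw f (d := [fset k]%fset)); last exact: msuppU_le.
by rewrite big_seq_fset1 mcoeffUU scale1r.
Qed.

Lemma malg_ind (P : {malg K[I]} -> Prop) : P 0 ->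
  (forall a k x, P x -> P (a *: << k >> + x)) -> forall x, P x.
Proof.
move=> P0 PD x; rewrite (monalgE x).
elim: {1}(enum_fset (msupp x)) => [|k s IHs]; first by rewrite big_nil.
rewrite big_cons; have -> : << x@_k *g k >> = x@_k *: << k >>.
  by apply/malgP => l; rewrite mcoeffZ !mcoeffU mulrnAr mulr1.
exact: PD.
Qed.

End LinearExtension.

Section BracketFromBasis.
Context {K : fieldType} {G : lmodType K} {I : Type} (e : I -> G).
Context (br : G -> G -> G).
Hypothesis e_ind : forall P : G -> Prop, P 0 ->
  (forall a k x, P x -> P (a *: e k + x)) -> forall x, P x.
Hypothesis brDl : forall y, linear (br^~ y).
Hypothesis brDr : forall x, linear (br x).
Hypothesis brxx_e : forall k, br (e k) (e k) = 0.
Hypothesis brC_e : forall k l, br (e k) (e l) = - br (e l) (e k).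

Let brPl a x x' y : br (a *: x + x') y = a *: br x y + br x' y.
Proof. exact: brDl. Qed.
Let brPr a x y y' : br x (a *: y + y') = a *: br x y + br x y'.
Proof. exact: brDr. Qed.

Lemma br0l z : br 0 z = 0.
Proof. by have := brPl (-1) 0 0 z; rewrite scaler0 addr0 scaleN1r addNr. Qed.
Lemma br0r z : br z 0 = 0.
Proof. by have := brPr (-1) z 0 0; rewrite scaler0 addr0 scaleN1r addNr. Qed.

Lemma brC_ext x y : br x y = - br y x.
Proof.
elim/e_ind: x => [|a k x IHx]; first by rewrite br0l br0r oppr0.
rewrite brPl brPr opprD IHx -scalerN; congr (_ *: _ + _).
elim/e_ind: y {IHx} => [|b l y IHy]; first by rewrite br0l br0r oppr0.
by rewrite brPl brPr opprD IHy -scalerN brC_e.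
Qed.

Lemma brxx_ext x : br x x = 0.
Proof.
elim/e_ind: x => [|a k x IHx]; first by rewrite br0l.
rewrite brPl !brPr brxx_e scaler0 add0r IHx addr0.
by rewrite (brC_ext x) scalerN addrN.
Qed.

Local Notation jac x y z :=
  (br x (br y z) + br y (br z x) + br z (br x y)).

Lemma jac_cycle x y z : jac x y z = jac y z x.
Proof. by rewrite -addrA addrC. Qed.

Lemma jac_ind y z : (forall k, jac (e k) y z = 0) -> forall x, jac x y z = 0.
Proof.
move=> H x; elim/e_ind: x => [|a k x IHx].
  by rewrite !(br0l, br0r) !addr0.
have -> : jac (a *: e k + x) y z = a *: jac (e k) y z + jac x y z.
  by rewrite !(brPl, brPr) !scalerDr [RHS]addrACA [in RHS](addrACA (a *: _)).
by rewrite H IHx scaler0 addr0.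
Qed.

Lemma jac_ext : (forall k l m, jac (e k) (e l) (e m) = 0) ->
  forall x y z, jac x y z = 0.
Proof.
move=> H x y z; apply: jac_ind => k.
rewrite jac_cycle; apply: jac_ind => l.
rewrite jac_cycle; apply: jac_ind => m.
by rewrite jac_cycle; exact: H.
Qed.

End BracketFromBasis.

(* [Some (a, i)] indexes the basis vector L_{a,i}, [None] indexes C *)
Definition Bidx : Type := option (int * nat).
HB.instance Definition _ := Choice.on Bidx.

Section BasisBracket.
Context {K : fieldType} {G : lmodType K} (e : Bidx -> G).

Definition basis_bracket (k l : Bidx) : G :=
  match k, l with
  | Some (a, i), Some (b, j) =>
      (i.+1%:Z * b - j.+1%:Z * a)%:~R *: e (Some (a + b, (i + j)%N))
      + (((a + b == 0)%:R * ((i + j)%N == 0%N)%:R)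
           * ((a ^+ 3 - a)%:~R / 6%:R)) *: e None
  | _, _ => 0
  end.

Lemma basis_bracketxx k : basis_bracket k k = 0.
Proof.
case: k => [[a i]|//] /=; rewrite subrr scale0r add0r.
have [a0|_] := eqVneq (a + a) 0; last by rewrite !mul0r scale0r.
have -> : a = 0.
  by apply/eqP; move/eqP: a0; rewrite -mulr2n mulrn_eq0.
by rewrite expr0n subrr mul0r mulr0 scale0r.
Qed.

Lemma basis_bracketC k l : basis_bracket k l = - basis_bracket l k.
Proof.
case: k l => [[a i]|] [[b j]|] //=; rewrite ?oppr0 // opprD -!scaleNr.
rewrite (addrC b a) (addnC j i); congr (_ *: _ + _ *: _).
  by rewrite -rmorphN opprB.
have [ab0|_] := eqVneq (a + b) 0; last by rewrite !mul0r oppr0.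
have -> : b = - a by rewrite -(addKr a b) ab0 addr0.
rewrite -mulrN -mulNr -rmorphN; congr (_ * (_%:~R / _)); ring.
Qed.

Variable br : G -> G -> G.
Hypothesis brDr : forall x, linear (br x).
Hypothesis brE : forall k l, br (e k) (e l) = basis_bracket k l.

Lemma basis_jacobi k l m :
  br (e k) (br (e l) (e m)) + br (e l) (br (e m) (e k))
  + br (e m) (br (e k) (e l)) = 0.
Proof.
have br0 x : br x 0 = 0 := br0r brDr x.
have brN x y : br (e x) (basis_bracket y None) = 0.
  by case: y => [[? ?]|]; exact: br0.
have brN' x y : br (e x) (basis_bracket None y) = 0 by exact: br0.
have brZ x t y : br x (t *: y) = t *: br x y.
  by have /= := brDr x t y 0; rewrite br0 !addr0.
have brS x b j c n : br (e x) (basis_bracket (Some (b, j)) (Some (c, n)))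
    = (j.+1%:Z * c - n.+1%:Z * b)%:~R
        *: basis_bracket x (Some (b + c, (j + n)%N)).
  rewrite [X in br _ X]/= (brDr (e x)) brE.
  rewrite brZ brE; suff -> : basis_bracket x None = 0 by rewrite scaler0 addr0.
  by case: (x) => [[]|].
have brN2 y z : br (e None) (basis_bracket y z) = 0.
  case: y z => [[b j]|] [[c n]|]; rewrite ?brN ?brN' //.
  by rewrite brS scaler0.
rewrite !brE; case: k l m => [[a i]|] [[b j]|] [[c n]|];
  rewrite ?brN2 ?brN ?brN' ?addr0 ?add0r //.
rewrite !brS /= !scalerDr !scalerA.
have -> : b + (c + a) = a + (b + c) by ring.
have -> : c + (a + b) = a + (b + c) by ring.
have -> : (j + (n + i) = i + (j + n))%N by rewrite (addnC n i) addnCA.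
have -> : (n + (i + j) = i + (j + n))%N by rewrite addnC -addnA.
have comb x1 y1 x2 y2 x3 y3 (u v : G) :
    (x1 *: u + y1 *: v) + (x2 *: u + y2 *: v) + (x3 *: u + y3 *: v)
    = (x1 + x2 + x3) *: u + (y1 + y2 + y3) *: v.
  by rewrite !scalerDl [RHS]addrACA [in RHS](addrACA (x1 *: u)).
rewrite comb; set u := e (Some _); set v := e None.
rewrite -[RHS](addr0 0) -[X in _ = X + _](scale0r u).
rewrite -[X in _ = _ + X](scale0r v).
congr (_ *: _ + _ *: _).
  rewrite -!intrM -!intrD -[RHS]/(0%:~R); congr (_%:~R).
  by rewrite !intS !PoszD; ring.
have [abc|_] := eqVneq (a + (b + c)) 0; last by rewrite !mul0r !mulr0 !addr0.
have [ijn|_] := eqVneq (i + (j + n))%N 0%N; last first.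
  by rewrite !mulr0 !mul0r !mulr0 !addr0.
have [i0 j0 n0] : [/\ i = 0%N, j = 0%N & n = 0%N].
  by move/eqP: ijn; rewrite !addn_eq0 => /and3P[/eqP-> /eqP-> /eqP->].
rewrite i0 j0 n0 !mul1r !mulrA -!mulrDl -!intrM -!intrD.
have -> : a = - (b + c) by rewrite -[a](addrK (b + c)) abc add0r.
rewrite (_ : _ + _ = 0) ?mul0r //; ring.
Qed.

End BasisBracket.

Section Block.
Variable K : fieldType.

Definition B : Type := {malg K[Bidx]}.
HB.instance Definition _ := GRing.Lmodule.on B.

Definition Bbasis (k : Bidx) : B := << k >>.

Definition L (a : int) (i : nat) : B := Bbasis (Some (a, i)).
Definition C : B := Bbasis None.

Definition B_bracket (x y : B) : B :=
  lin_ext (fun k => lin_ext (basis_bracket Bbasis k) y) x.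

Lemma B_bracketDl y : linear (B_bracket^~ y).
Proof. exact: lin_ext_linear. Qed.

Lemma B_bracketDr x : linear (B_bracket x).
Proof.
move=> a y z; rewrite /B_bracket.
have E w : lin_ext (fun k => lin_ext (basis_bracket Bbasis k) w) x =
    \sum_(k <- msupp x) x@_k *: lin_ext (basis_bracket Bbasis k) w by [].
rewrite !E scaler_sumr -big_split /=; apply: eq_bigr => k _.
by rewrite lin_ext_linear scalerDr !scalerA mulrC.
Qed.

Lemma B_bracketU (k l : Bidx) :
  B_bracket (Bbasis k) (Bbasis l) = basis_bracket Bbasis k l.
Proof. by rewrite /B_bracket !lin_extU. Qed.

Lemma Bbasis_ind (P : B -> Prop) : P 0 ->
  (forall a k x, P x -> P (a *: Bbasis k + x)) -> forall x, P x.
Proof. exact: malg_ind. Qed.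

Lemma B_bracketxx x : B_bracket x x = 0.
Proof.
refine (brxx_ext Bbasis_ind B_bracketDl B_bracketDr _ _ x) => [k|k l].
  by rewrite B_bracketU; exact: basis_bracketxx.
by rewrite !B_bracketU; exact: basis_bracketC.
Qed.

Lemma B_jacobi x y z : B_bracket x (B_bracket y z)
  + B_bracket y (B_bracket z x) + B_bracket z (B_bracket x y) = 0.
Proof.
exact (jac_ext Bbasis_ind B_bracketDl B_bracketDr
  (basis_jacobi B_bracketDr B_bracketU) x y z).
Qed.

HB.instance Definition _ := Lmodule_isLieAlgebra.Build K B
  B_bracketDl B_bracketDr B_bracketxx B_jacobi.

Lemma lie_L a i b j : lie (L a i) (L b j) =
  (i.+1%:Z * b - j.+1%:Z * a)%:~R *: L (a + b) (i + j)%N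
  + (((a + b == 0)%:R * ((i + j)%N == 0%N)%:R)
       * ((a ^+ 3 - a)%:~R / 6%:R)) *: C.
Proof. exact: B_bracketU. Qed.

Lemma lie_C (x : B) : lie C x = 0.
Proof.
have E (f : Bidx -> Bidx -> B) y :
    lin_ext (fun k => lin_ext (f k) y) C = lin_ext (f None) y.
  exact: lin_extU.
rewrite [LHS]E /lin_ext; apply: big1 => k _; exact: scaler0.
Qed.

Definition B_deg (a : int) : set B :=
  span ([set x | exists i : nat, x = L a i] `|` [set x | a = 0 /\ x = C]).

(* The ideal spanned by the L_{a,i} with i >= 1, not the component of degree 1,
   which is [B_deg 1] *)
Definition B1 : set B :=
  span [set x | exists (a : int) (i : nat), (1 <= i)%N /\ x = L a i].

Definition Vir_set : set B :=
  span ([set x | exists a : int, x = L a 0%N] `|` [set C]).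

Definition Vir_pred : {pred B} := fun x => `[< Vir_set x >].

Lemma Vir_submod_closed : submod_closed Vir_pred.
Proof.
have [V0 VD] := span_subspace ([set x | exists a, x = L a 0%N] `|` [set C]).
split; first exact/asboolP.
by move=> a x y /asboolP Vx /asboolP Vy; apply/asboolP; exact: VD.
Qed.

HB.instance Definition _ :=
  GRing.isSubmodClosed.Build K B Vir_pred Vir_submod_closed.

Record Vir : Type := MkVir { Vir_val :> B; _ : Vir_pred Vir_val }.
HB.instance Definition _ := [isSub for Vir_val].
HB.instance Definition _ := [Choice of Vir by <:].
HB.instance Definition _ := [SubChoice_isSubLmodule of Vir by <:].

Lemma Vir_lie_closed (x y : B) :
  Vir_pred x -> Vir_pred y -> Vir_pred (lie x y).
Proof.
have [V0 VD] : subspace Vir_set := span_subspace _.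
have lie0 z : lie 0 z = 0 :> B.
  by have := lie_linearl z (-1) 0 0; rewrite /= scaler0 addr0 scaleN1r addNr.
have lie0r z : lie z 0 = 0 :> B.
  by have := lie_linearr z (-1) 0 0; rewrite /= scaler0 addr0 scaleN1r addNr.
have VZ t (z : B) : Vir_set z -> Vir_set (t *: z).
  by move=> Vz; rewrite -[t *: z]addr0; apply: VD.
move=> /asboolP Vx /asboolP Vy; apply/asboolP; move: x Vx y Vy.
apply: span_ind => [|x Sx].
  split=> [y _|t x x' Vx Vx' y Vy]; first by rewrite lie0.
  have /= -> := lie_linearl y t x x'.
  by apply: VD; [exact: Vx|exact: Vx'].
apply: span_ind => [|y Sy].
  split=> [|t y y' Vy Vy']; first by rewrite /= lie0r.
  by have /= -> := lie_linearr x t y y'; exact: VD.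
have LC : exists k l, [/\ x = Bbasis k, y = Bbasis l &
    Vir_set (basis_bracket Bbasis k l)].
  have VL a : Vir_set (L a 0) by apply: span_gen; left; exists a.
  have VC : Vir_set C by apply: span_gen; right.
  case: Sx => [[a ->]|->]; last first.
    by case: Sy => [[b ->]|->]; exists None; eexists; split.
  case: Sy => [[b ->]|->]; last by exists (Some (a, 0%N)), None; split.
  exists (Some (a, 0%N)), (Some (b, 0%N)); split=> //.
  by apply: VD; [exact: VL|exact: VZ].
by case: LC => k [l [-> -> Vkl]]; rewrite /= /lie /= B_bracketU.
Qed.

Definition Vir_lie (x y : Vir) : Vir :=
  MkVir (Vir_lie_closed (valP x) (valP y)).

Lemma Vir_lieDl y : linear (Vir_lie^~ y).
Proof. by move=> t x x'; apply: val_inj; exact: lie_linearl. Qed.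

Lemma Vir_lieDr x : linear (Vir_lie x).
Proof. by move=> t y y'; apply: val_inj; exact: lie_linearr. Qed.

Lemma Vir_liexx x : Vir_lie x x = 0.
Proof. by apply: val_inj; exact: liexx. Qed.

Lemma Vir_jacobi x y z : Vir_lie x (Vir_lie y z)
  + Vir_lie y (Vir_lie z x) + Vir_lie z (Vir_lie x y) = 0.
Proof. by apply: val_inj; exact: lie_jacobi. Qed.

HB.instance Definition _ := Lmodule_isLieAlgebra.Build K Vir
  Vir_lieDl Vir_lieDr Vir_liexx Vir_jacobi.

Definition Vir_deg (a : int) : set Vir := [set x | B_deg a (Vir_val x)].

Definition restrict_Vir (V : lmodType K) (act : B -> V -> V) : Vir -> V -> V :=
  fun x => act (Vir_val x).

End Block.

(* Main.v *)
Require Import Defs.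
From mathcomp Require Import all_boot all_order all_algebra.
From mathcomp Require Import classical_sets reals complex.
From mathcomp Require Import ring.

(** The dependence of the action of L_{b,i} on i is forced by L_{0,1} to be
    exponential, which is incompatible with brackets that are affine in i.

    Since dim V_g <= 1 and L_{0,1} has degree 0, it acts on each V_g by a
    scalar l(g).  For b <> 0 the relation [L_{0,1}, L_{b,i}] = 2b L_{b,i+1}
    then says that, on V_g, L_{b,i+1} = t L_{b,i} with
    t = (l(g+b) - l(g)) / 2b, so L_{b,i} = t^i L_{b,0} on V_g: the action is
    purely exponential in i ([L_act_geometric]).

    On the other hand, the structure constants are affine in i.  For n <> 0 the
    bracket [L_{2n,i}, L_{-n,0}] = -n(i+3) L_{n,i}, applied to v in V_g, reads
    s^i P - r^i Q = -n(i+3) u^i R, where R = L_{n,0} v and u R = L_{n,1} v.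
    A sequence of the form (i+3) u^i has a double root in its recurrence and is
    not a combination of two plain exponentials unless u R = 0
    ([affine_exp_eq0]).  Hence L_{n,i} v = 0 for all i >= 1 and n <> 0, and
    L_{0,i}, a multiple of [L_{1,i}, L_{-1,0}], vanishes too.  The gradation
    restricts to Vir without change. *)

Set Implicit Arguments.
Unset Strict Implicit.
Unset Printing Implicit Defensive.

Import Order.TTheory GRing.Theory Num.Theory.
Local Open Scope classical_set_scope.
Local Open Scope ring_scope.

(** Cancelling the term in b, then the one in a, leaves a multiple of R for each
    i; those for i = 0 and i = 1 force u = a = b as soon as u R <> 0, and
    then P - Q would have to equal both x R and (x + 1) R. *)
Lemma affine_exp_eq0 (K : fieldType) (V : lmodType K) (a b u x : K)
    (P Q R : V) :
  (forall i, a ^+ i *: P - b ^+ i *: Q = ((x + i%:R) * u ^+ i) *: R) ->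
  u *: R = 0.
Proof.
move=> H.
pose f i : K := (x + i%:R) * u ^+ i.
have f_b i : (f i.+1 - b * f i) *: R = ((a - b) * a ^+ i) *: P.
  rewrite scalerBl -(scalerA b) -!H scalerBr !scalerA -exprS.
  by rewrite opprB addrA subrK -scalerBl exprS mulrBl.
have f_ab i : (f i.+2 - b * f i.+1 - a * (f i.+1 - b * f i)) *: R = 0.
  rewrite scalerBl -(scalerA a) !f_b scalerA -scalerBl exprS.
  by rewrite mulrCA subrr scale0r.
have [->|R0] := eqVneq R 0; first by rewrite scaler0.
have [->|u0] := eqVneq u 0; first by rewrite scale0r.
have f_ab0 i : f i.+2 - b * f i.+1 - a * (f i.+1 - b * f i) = 0.
  by apply/eqP; move/eqP: (f_ab i); rewrite scaler_eq0 (negbTE R0) orbF.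
have root : (u - a) * (u - b) = 0.
  apply: (mulfI u0); rewrite mulr0 -[RHS](subrr 0).
  rewrite -{1}(f_ab0 1%N) -(mulr0 u) -(f_ab0 0%N) /f; ring.
(* the derivative of (X - a)(X - b) at u: the root is double *)
have droot : (u - a) + (u - b) = 0.
  apply: (mulfI u0); rewrite mulr0 -[RHS](subr0 0) -[X in _ = _ - X](mulr0 x).
  rewrite -{1}(f_ab0 0%N) -root /f; ring.
have [ua ub] : u = a /\ u = b.
  move/eqP: root; rewrite mulf_eq0 !subr_eq0 => /orP[]/eqP E; move: droot.
    by rewrite {1}E subrr add0r => /eqP; rewrite subr_eq0 => /eqP.
  by rewrite {2}E subrr addr0 => /eqP; rewrite subr_eq0 => /eqP.
have E0 := H 0%N; have E1 := H 1%N; move: E0 E1.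
rewrite -ua -ub !expr0 !expr1 !scale1r mulr1 addr0 -scalerBr => ->.
rewrite scalerA => /eqP; rewrite -subr_eq0 -scalerBl.
by rewrite (_ : _ - _ = - u) ?scaleNr ?oppr_eq0 => [/eqP|]; last ring.
Qed.

Lemma linear_fun0 (K : fieldType) (V W : lmodType K) (f : V -> W) :
  linear f -> f 0 = 0.
Proof.
by move=> flin; have := flin (-1) 0 0; rewrite scaler0 addr0 scaleN1r addNr.
Qed.

Lemma linear_funZ (K : fieldType) (V W : lmodType K) (f : V -> W) a v :
  linear f -> f (a *: v) = a *: f v.
Proof.
by move=> flin; have := flin a v 0; rewrite (linear_fun0 flin) !addr0.
Qed.

Lemma degree_zero_scalar (K : fieldType) (V : lmodType K) (W : set V)
    (f : V -> V) :
  linear f -> dim_le W 1 -> (forall v, W v -> W (f v)) ->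
  exists l : K, forall v, W v -> f v = l *: v.
Proof.
move=> flin [e [We eP]] Wf.
have [c] := eP _ (Wf _ (We ord0)); rewrite big_ord1 => fe.
exists (c ord0) => v /eP[d ->].
by rewrite big_ord1 (linear_funZ _ _ flin) fe !scalerA mulrC.
Qed.

Lemma graded_eq0 (K : fieldType) (V : lmodType K) (Vd : int -> set V)
    (f : V -> V) :
  linear f -> direct_sum_decomposition Vd ->
  (forall g v, Vd g v -> f v = 0) -> forall v, f v = 0.
Proof.
move=> flin [_ dec _] fVd v.
have [s [w [_ Vw ->]]] := dec v.
elim/big_ind: _ => [|x y fx fy|i _]; [exact: linear_fun0| |exact: fVd (Vw i)].
by have := flin 1 x y; rewrite !scale1r fx fy addr0.
Qed.

Section IntermediateSeries.
Context {K : numFieldType} {V : lmodType K} {Vd : int -> set V}.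
Context {act : B K -> V -> V}.
Context (HV : intermediate_series (@B_deg K) Vd act).

Let act_linl v : linear (act^~ v).
Proof. by case: HV => -[[H _ _] _ _] _; exact: H. Qed.

Let act_linr x : linear (act x).
Proof. by case: HV => -[[_ H _] _ _] _; exact: H. Qed.

Let act_lie x y v : act (lie x y) v = act x (act y v) - act y (act x v).
Proof. by case: HV => -[[_ _ H] _ _] _; exact: H. Qed.

Let act0l v : act 0 v = 0.
Proof. exact: linear_fun0 (act_linl v). Qed.

Let actZl a x v : act (a *: x) v = a *: act x v.
Proof. exact: linear_funZ (act_linl v). Qed.

Let act0r x : act x 0 = 0.
Proof. exact: linear_fun0 (act_linr x). Qed.

Let actZr a x v : act x (a *: v) = a *: act x v.
Proof. exact: linear_funZ (act_linr x). Qed.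

Let L_deg a i g v : Vd g v -> Vd (a + g) (act (L K a i) v).
Proof.
case: HV => -[_ _ H] _; apply: H; apply: span_gen.
by left; exists i.
Qed.

Lemma act_lie_L a i b j v : (a + b != 0) || (i + j != 0)%N ->
  act (L K a i) (act (L K b j) v) - act (L K b j) (act (L K a i) v)
  = (i.+1%:Z * b - j.+1%:Z * a)%:~R *: act (L K (a + b) (i + j)) v.
Proof.
move=> nc; rewrite -act_lie lie_L.
suff -> : (a + b == 0)%:R * (i + j == 0)%N%:R = 0 :> K.
  by rewrite mul0r scale0r addr0 actZl.
by case/orP: nc => /negbTE ->; rewrite ?mul0r ?mulr0.
Qed.

(** Bracketing with L_{0,1}, which is a scalar on each of V_g and V_{b+g},
    raises the second index by one: the ratio t is the difference of these
    scalars over 2b. *)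
Lemma L_act_geometric (b g : int) : b != 0 ->
  exists t : K, forall i v, Vd g v ->
    act (L K b i) v = t ^+ i *: act (L K b 0) v.
Proof.
move=> b0.
have scal h : exists l : K, forall v, Vd h v -> act (L K 0 1) v = l *: v.
  apply: degree_zero_scalar; first exact: act_linr.
    by case: HV => _; apply.
  by move=> v Vv; rewrite -(add0r h); exact: L_deg.
have [l lP] := scal g; have [m mP] := scal (b + g).
exists ((m - l) / (2%:Z * b)%:~R); elim=> [|i IHi] v Vv.
  by rewrite expr0 scale1r.
have /= := @act_lie_L 0 1 b i v; rewrite orbT => /(_ isT).
rewrite mulr0 subr0 add0r add1n (mP _ (@L_deg _ _ _ _ Vv)) (lP _ Vv) actZr.
rewrite -scalerBl (IHi _ Vv) => E.
have b2 : (2%:Z * b)%:~R != 0 :> K by rewrite intr_eq0 mulf_neq0.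
apply: (scalerI b2); rewrite -E !scalerA exprS; congr (_ *: _).
by rewrite !mulrA (mulrC _ (m - l)) mulfK.
Qed.

Lemma L_act_eq0_homogeneous (n g : int) (i : nat) v :
  n != 0 -> (0 < i)%N -> Vd g v -> act (L K n i) v = 0.
Proof.
move=> n0 i0 Vv.
(* n = 2n + (-n) splits n into two nonzero degrees, uniformly in n *)
have n20 : n + n != 0 by rewrite -mulr2n mulrn_eq0.
have [u uP] := L_act_geometric g n0.
have [a aP] := L_act_geometric (- n + g) n20.
have [b bP] := L_act_geometric g n20.
suff u0 : u *: act (L K n 0) v = 0.
  by case: i i0 => // i _; rewrite (uP _ _ Vv) exprSr -scalerA u0 scaler0.
have nN0 : (- n)%:~R != 0 :> K by rewrite intr_eq0 oppr_eq0.
apply: (scalerI nN0); rewrite scaler0 scalerA mulrC -scalerA.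
apply: (@affine_exp_eq0 _ _ a b u 3%:R
  (act (L K (n + n) 0) (act (L K (- n) 0) v))
  (act (L K (- n) 0) (act (L K (n + n) 0) v))) => k.
rewrite -(aP _ _ (@L_deg _ _ _ _ Vv)) -actZr -(bP _ _ Vv).
rewrite act_lie_L addrK ?n0 // addn0 (uP _ _ Vv) !scalerA.
congr (_ *: _); rewrite (_ : _ - _ = (3 + k%:Z) * - n); last first.
  by rewrite intS; ring.
by rewrite intrM intrD /= -!pmulrn mulrAC.
Qed.

Lemma L_act_eq0 (a : int) (i : nat) v : (0 < i)%N -> act (L K a i) v = 0.
Proof.
move=> i0.
have nz n w : n != 0 -> act (L K n i) w = 0.
  move=> n0; have [[_ dec _] _] := HV.
  by apply: (graded_eq0 (act_linr _) dec) => g x; exact: L_act_eq0_homogeneous.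
have [->|] := eqVneq a 0; last exact: nz.
(* [L_{1,i}, L_{-1,0}] = -(i+2) L_{0,i} when i > 0 *)
have /= := @act_lie_L 1 i (-1) 0 v; rewrite subrr addn0 -lt0n i0 => /(_ isT).
rewrite (nz 1) // (nz 1) // act0r subr0 mulrN1 mulr1 -opprD => /esym/eqP.
by rewrite scaler_eq0 intr_eq0 oppr_eq0 -PoszD => /eqP.
Qed.

Lemma B1_act_eq0 x v : B1 x -> act x v = 0.
Proof.
have ker : subspace [set y | act y v = 0].
  split=> [|c y z /= y0 z0]; first exact: act0l.
  by have /= -> := act_linl v c y z; rewrite y0 z0 scaler0 addr0.
apply: (span_ind ker) => _ [a [i [i1 ->]]].
exact: L_act_eq0.
Qed.

Lemma restrict_Vir_intermediate_series :
  intermediate_series (@Vir_deg K) Vd (restrict_Vir act).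
Proof.
have [[_ dec deg] dim] := HV; split=> //; split=> //.
  split=> [v c x y|x|x y v]; [exact: act_linl|exact: act_linr|exact: act_lie].
by move=> a b x v; exact: deg.
Qed.

End IntermediateSeries.

Theorem corollary1p2 (R : realType) (V : lmodType R[i]) (Vd : int -> set V)
    (act : B R[i] -> V -> V) :
  intermediate_series (@B_deg R[i]) Vd act ->
  (forall (x : B R[i]) (v : V), B1 x -> act x v = 0%R) /\
  intermediate_series (@Vir_deg R[i]) Vd (restrict_Vir act).
Proof.
move=> HV; split; first exact: (B1_act_eq0 HV).
exact: (restrict_Vir_intermediate_series HV).
Qed.
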